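(* Let $E$ be a real Banach space of dimension at least two and let $G\subsetneq E$ be a domain. Then the following hold. (i) If $G$ is a $c$-John domain for some $c\ge 1$, then $G$ has the minimizing property. (ii) $G$ has the minimizing property if and only if $G$ is a diameter $c_1$-John domain for some constant $c_1\ge 1$.
   Context: A domain is an open connected set. The norm of $E$ is written $|\cdot|$; $\delta G=\overline G\setminus G$ is the boundary of $G$, and $\delta_G(x)=\inf\{|x-y|:y\in\delta G\}$ for $x\in G$. A curve is a continuous map from a closed interval into $E$; it joins $x_1$ and $x_2$ if these are its endpoints. For points $u,v$ on a curve $\gamma$, $\gamma[u,v]$ is the part of $\gamma$ from $u$ to $v$, $l$ denotes length, and $\mathrm{diam}$ denotes diameter in the norm metric. For $c\ge 1$, a domain $G\subsetneq E$ is $c$-John (also called length $c$-John) if each pair of points $x_1,x_2\in G$ can be joined by a curve $\gamma$ in $G$ with $\min_{j=1,2} l(\gamma[x_j,x])\le c\,\delta_G(x)$ for all $x\in\gamma$. It is diameter $c$-John if the same holds with $l(\gamma[x_j,x])$ replaced by $\mathrm{diam}(\gamma[x_j,x])$. $G$ has the minimizing property if there exist a family $\Gamma$ of curves in $G$ and a constant $c$ such that each pair of points in $G$ can be joined by a curve $\gamma\in\Gamma$ satisfying $\min_{j=1,2}|x_j-y|\le c|x-y|$ for each ordered triple of points $x_1,x,x_2\in\gamma$ (i.e. $x$ lies between $x_1$ and $x_2$ along $\gamma$) and each $y\in\delta G$. *)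

(* Defs.v *)
From HB Require Import structures.
From mathcomp Require Import all_boot all_order all_algebra.
From mathcomp Require Import all_classical all_reals all_analysis.
Set Implicit Arguments.
Unset Strict Implicit.
Unset Printing Implicit Defensive.
Import Order.TTheory GRing.Theory Num.Theory.
Import numFieldNormedType.Exports.
Local Open Scope classical_set_scope.
Local Open Scope ring_scope.

Definition dim_ge2 (R : realType) (E : lmodType R) : Prop :=
  exists u v : E, forall a b : R, a *: u + b *: v = 0 -> a = 0 /\ b = 0.

Definition domain (T : topologicalType) (G : set T) : Prop :=
  open G /\ connected G.

(* For open G this is the topological boundary. *)
Definition boundary (T : topologicalType) (G : set T) : set T :=
  closure G `\` G.

(* The boundary of a nonempty proper domain of a normed space is nonempty,
   so the infimum below is never that of the empty set (conventionally 0)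
   when x lies in such a domain G. *)
Definition bdist (R : realType) (E : normedModType R) (G : set E) (x : E) : R :=
  inf [set `|x - y| | y in boundary G].

(* Only the values of param on [lo, hi] are meaningful. *)
Record curve (R : realType) (E : normedModType R) := Curve {
  lo : R;
  hi : R;
  param : R -> E;
  lo_le_hi : lo <= hi;
  param_continuous : {within `[lo, hi], continuous param} }.

Section Curves.
Context {R : realType} {E : normedModType R}.
Implicit Types (g : curve E) (G : set E).

Definition in_set_curve g G : Prop := param g @` `[lo g, hi g] `<=` G.

Definition joins g (x1 x2 : E) : Prop :=
  param g (lo g) = x1 /\ param g (hi g) = x2.

(* A curve need not be injective, so a subarc g[u, v] is described by the
   parameters s <= t of its endpoints rather than by the points themselves. *)
Definition subarc g (s t : R) : set E := param g @` `[s, t].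

(* The library's variation and total_variation, for E-valued maps. *)
Definition arc_variation g (s t : R) (l : seq R) : R :=
  let F := param g \o nth t (s :: l) in
  \sum_(0 <= n < size l) `|F n.+1 - F n|.

Definition arc_length g (s t : R) : \bar R :=
  ereal_sup [set (arc_variation g s t l)%:E | l in itv_partition s t].

Definition diam (A : set E) : \bar R :=
  ereal_sup [set `|p.1 - p.2|%:E | p in A `*` A].

Definition John (c : R) G : Prop :=
  forall x1 x2 : E, G x1 -> G x2 ->
  exists g : curve E, [/\ in_set_curve g G, joins g x1 x2 &
    forall t : R, lo g <= t <= hi g ->
      (mine (arc_length g (lo g) t) (arc_length g t (hi g))
         <= (c * bdist G (param g t))%:E)%E].

Definition diam_John (c : R) G : Prop :=
  forall x1 x2 : E, G x1 -> G x2 ->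
  exists g : curve E, [/\ in_set_curve g G, joins g x1 x2 &
    forall t : R, lo g <= t <= hi g ->
      (mine (diam (subarc g (lo g) t)) (diam (subarc g t (hi g)))
         <= (c * bdist G (param g t))%:E)%E].

Definition minimizing G : Prop :=
  exists (Gamma : set (curve E)) (c : R),
    (forall g, Gamma g -> in_set_curve g G) /\
    (forall x1 x2 : E, G x1 -> G x2 ->
     exists g : curve E, [/\ Gamma g, joins g x1 x2 &
       forall s1 s s2 : R, lo g <= s1 -> s1 <= s -> s <= s2 -> s2 <= hi g ->
       forall y : E, boundary G y ->
         Num.min `|param g s1 - y| `|param g s2 - y| <= c * `|param g s - y|]).

End Curves.

(* Main.v *)
Require Import Defs.
From HB Require Import structures.
From mathcomp Require Import all_boot all_order all_algebra.
From mathcomp Require Import all_classical all_reals all_analysis.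
Import Order.TTheory GRing.Theory Num.Theory.
Import numFieldNormedType.Exports.
Local Open Scope classical_set_scope.
Local Open Scope ring_scope.

(** The length of an arc dominates the distance between any two of its points,
    hence its diameter, so a John domain is a diameter John domain with the same
    constant ([John_diam_John]); it remains to compare the diameter condition
    with the minimizing property, and both say that near every point [x] of the
    curve one of the two sides of the curve stays at distance [O(bdist G x)]
    from [x].

    If the side towards [x1] has diameter at most [c * bdist G x], then every
    point [p] of it satisfies, for each boundary point [y],
    [|p - y| <= |p - x| + |x - y| <= (c + 1) * |x - y|], because
    [bdist G x <= |x - y|]; this is the minimizing inequality
    ([diam_John_minimizing]).

    Conversely, from [|p - y| <= c * |x - y|] the triangle inequality gives
    [|p - x| <= (c + 1) * |x - y|], and taking the infimum over [y] turns the
    minimizing property into: for all [p1], [p2] on the two sides of [x], one of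
    [|p1 - x|], [|p2 - x|] is at most [r = (c + 1) * bdist G x].  As soon as one
    point of the first side is farther than [r] from [x], the whole second side
    is within [r] of [x]; so one side lies in a ball of radius [r] and has
    diameter at most [2 * r] ([minimizing_diam_John]).  The infimum step needs a
    boundary point, which exists because a normed space is connected
    ([boundary_nonempty]). *)

Section BoundaryDistance.
Context {R : realType} {E : normedModType R}.
Implicit Types (G : set E) (x y : E).

(** Otherwise [G] would be clopen, and so would its trace on the line through a
    point of [G] and a point outside [G]. *)
Lemma boundary_nonempty G :
  open G -> G !=set0 -> G `<` [set: E] -> boundary G !=set0.
Proof.
move=> oG [a Ga] [_ nGT]; apply: contrapT => bG0; apply: nGT => b _.
have cG : closed G.
  by move=> y Gy; apply: contrapT => nGy; apply: bG0; exists y.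
pose f (t : R) : E := a + t *: (b - a).
have cf : continuous f.
  by move=> t; apply: cvgD; [exact: cvg_cst | apply: cvgZr_tmp; exact: cvg_id].
have [oGf cGf] : clopen (f @^-1` G) by exact: preimage_clopen.
have cR : connected [set: R] by apply/connected_intervalP.
have GfT : f @^-1` G = setT.
  apply: cR.
  - by exists 0; rewrite /= /f scale0r addr0.
  - by exists (f @^-1` G) => //; rewrite setTI.
  - by exists (f @^-1` G) => //; rewrite setTI.
have : (f @^-1` G) 1 by rewrite GfT.
by rewrite /= /f scale1r addrC subrK.
Qed.

Lemma bdist_le G x y : boundary G y -> bdist G x <= `|x - y|.
Proof.
move=> Gy; apply: ge_inf; last by exists y.
by exists 0 => _ [z _ <-].
Qed.

Lemma le_mul_bdist G x (c m : R) : 0 < c -> boundary G !=set0 ->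
  (forall y, boundary G y -> m <= c * `|x - y|) -> m <= c * bdist G x.
Proof.
move=> c0 [y0 Gy0] mle; rewrite -ler_pdivrMl//.
apply: lb_le_inf; first by exists `|x - y0|, y0.
by move=> _ [y Gy <-]; rewrite ler_pdivrMl//; exact: mle.
Qed.

End BoundaryDistance.

Section DiameterLength.
Context {R : realType} {E : normedModType R}.
Implicit Types (A : set E) (g : curve E).

Lemma dist_le_diam A (a b : E) : A a -> A b -> (`|a - b|%:E <= diam A)%E.
Proof. by move=> Aa Ab; apply: ereal_sup_ubound; exists (a, b). Qed.

Lemma diam_le_ball A (x : E) (r : R) :
  (forall a, A a -> `|a - x| <= r) -> (diam A <= (2 * r)%:E)%E.
Proof.
move=> Ar; apply: ge_ereal_sup => _ [[a b] [/= Aa Ab] <-].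
rewrite lee_fin (le_trans (ler_distD x _ _))// mulrDl mul1r.
by rewrite lerD ?Ar// distrC Ar.
Qed.

Lemma dist_le_arc_length g (s u v t : R) : s <= u -> u <= v -> v <= t ->
  (`|param g u - param g v|%:E <= arc_length g s t)%E.
Proof.
(* It suffices to find a partition of [s, t] one of whose increments is the
   chord from u to v.  Partitions are strictly increasing and leave their first
   point s implicit, so the list depends on which of s <= u <= v <= t are
   equalities; when u = v the chord is 0 and any partition will do. *)
move=> su uv vt.
have len l : itv_partition s t l ->
    `|param g u - param g v| <= arc_variation g s t l ->
    (`|param g u - param g v|%:E <= arc_length g s t)%E.
  move=> lP le_l; apply: (@le_trans _ _ (arc_variation g s t l)%:E).
    by rewrite lee_fin.
  by apply: ereal_sup_ubound; exists l.
move: uv; rewrite le_eqVlt => /predU1P[uv|uv].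
  move: len; rewrite uv subrr normr0 => len; move: su vt.
  rewrite -uv => su ut; have := le_trans su ut.
  rewrite le_eqVlt => /predU1P[st|st].
    apply: (len [::]); first by split=> //=; rewrite st.
    exact: sumr_ge0.
  by apply: (len [:: t]); [exact: itv_partition1 | exact: sumr_ge0].
move: su; rewrite le_eqVlt => /predU1P su.
move: vt; rewrite le_eqVlt => /predU1P vt.
case: su vt => su [] vt.
- apply: (len [:: v]); first by split; rewrite /= ?vt// -vt su uv.
  by rewrite /arc_variation /= big_nat1 /= su distrC.
- apply: (len [:: v; t]); first by split; rewrite //= su uv vt.
  by rewrite /arc_variation /= big_nat_recl// big_nat1 /= su distrC lerDl.
- apply: (len [:: u; v]); first by split; rewrite /= ?vt// su -vt uv.
  by rewrite /arc_variation /= big_nat_recl// big_nat1 /= distrC lerDr.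
- apply: (len [:: u; v; t]); first by split; rewrite //= su uv vt.
  rewrite /arc_variation /= !big_nat_recl// big_geq// addr0 /=.
  by rewrite [X in _ <= _ + (X + _)]distrC addrCA lerDl addr_ge0.
Qed.

Lemma diam_subarc_le_arc_length g (s t : R) :
  (diam (subarc g s t) <= arc_length g s t)%E.
Proof.
apply: ge_ereal_sup => _ [[_ _] [/= [u + <-] [v + <-]] <-].
rewrite /= !in_itv/= => /andP[su ut] /andP[sv vt].
have [uv|/ltW vu] := leP u v; first exact: dist_le_arc_length.
by rewrite distrC; exact: dist_le_arc_length.
Qed.

End DiameterLength.

Section JohnMinimizing.
Context {R : realType} {E : normedModType R}.
Implicit Types (G : set E) (c : R).

Lemma John_diam_John c G : John c G -> diam_John c G.
Proof.
move=> JG x1 x2 Gx1 Gx2; have [g [gG gx Jg]] := JG _ _ Gx1 Gx2.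
exists g; split=> // t /Jg; apply: le_trans.
by apply: le_min2; exact: diam_subarc_le_arc_length.
Qed.

(** The side of small diameter contains both [param g s] and the outer point of
    the triple lying on that side, so that outer point realizes the minimum up
    to the constant. *)
Lemma diam_John_minimizing c G : 0 <= c -> diam_John c G -> minimizing G.
Proof.
move=> c0 JG.
(* The family must be fixed before the endpoints: all diameter c-John curves. *)
pose Gamma : set (curve E) := [set g | in_set_curve g G /\
  forall t, lo g <= t <= hi g ->
    (mine (diam (subarc g (lo g) t)) (diam (subarc g t (hi g)))
       <= (c * bdist G (param g t))%:E)%E].
exists Gamma, (c + 1); split; first by move=> g [].
move=> x1 x2 Gx1 Gx2; have [g [gG gx Jg]] := JG _ _ Gx1 Gx2.
exists g; split=> // s1 s s2 lo1 s1s ss2 s2hi y Gy.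
set x := param g s.
have near (A : set E) p : A p -> A x -> (diam A <= (c * bdist G x)%:E)%E ->
    `|p - y| <= (c + 1) * `|x - y|.
  move=> Ap Ax dA; rewrite mulrDl mul1r (le_trans (ler_distD x _ _))// lerD2r.
  rewrite (@le_trans _ _ (c * bdist G x))//; last first.
    by rewrite ler_wpM2l// bdist_le.
  by rewrite -lee_fin (le_trans _ dA)// dist_le_diam.
have los : lo g <= s by exact: le_trans s1s.
have shi : s <= hi g by exact: le_trans s2hi.
have := Jg s; rewrite los shi => /(_ isT); rewrite !ge_min => /orP[] side.
- apply/orP; left; apply: near side.
  + by exists s1 => //; rewrite /= in_itv/= lo1.
  + by exists s => //; rewrite /= in_itv/= los lexx.
- apply/orP; right; apply: near side.
  + by exists s2 => //; rewrite /= in_itv/= ss2.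
  + by exists s => //; rewrite /= in_itv/= lexx.
Qed.

(** The dichotomy between the two sides holds because a single
    far point on one side forces every point of the other side to be near.  The
    hypothesis on the boundary is conditional because both properties hold
    vacuously for the empty set, whose boundary is empty. *)
Lemma minimizing_diam_John G : (G !=set0 -> boundary G !=set0) ->
  minimizing G -> exists c : R, 1 <= c /\ diam_John c G.
Proof.
move=> bG [Gamma [c [GammaG minG]]].
(* The constant of the minimizing property comes without a sign, whereas the
   infimum over the boundary does not commute with negative factors. *)
pose k := Num.max 0 c.
have k0 : 0 <= k by rewrite le_max lexx.
have k1 : 0 < k + 1 by rewrite ltr_wpDl.
exists (2 * (k + 1)); split.
  by rewrite mulrDr mulr1 -[leLHS]add0r lerD ?mulr_ge0// ler1n.
move=> x1 x2 Gx1 Gx2; have [g [gGamma gx ming]] := minG _ _ Gx1 Gx2.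
have bG0 : boundary G !=set0 by apply: bG; exists x1.
exists g; split; [exact: GammaG | by []|] => t /andP[lot thi].
set x := param g t; pose r := (k + 1) * bdist G x.
have near (s1 s2 : R) : lo g <= s1 -> s1 <= t -> t <= s2 -> s2 <= hi g ->
    `|param g s1 - x| <= r \/ `|param g s2 - x| <= r.
  move=> lo1 s1t ts2 s2hi; apply/orP; rewrite -ge_min.
  apply: le_mul_bdist => // y Gy.
  have : Num.min `|param g s1 - y| `|param g s2 - y| <= k * `|x - y|.
    apply: le_trans (ming _ _ _ lo1 s1t ts2 s2hi y Gy) _.
    by rewrite ler_wpM2r// le_max lexx orbT.
  rewrite !ge_min => /orP[] le_y; apply/orP; [left|right];
    by rewrite mulrDl mul1r (le_trans (ler_distD y _ _))// lerD// distrC.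
rewrite -mulrA ge_min; apply/orP.
have [first_side|] :=
  pselect (forall s, lo g <= s <= t -> `|param g s - x| <= r).
  left; apply: (@diam_le_ball _ _ _ x) => _ [s + <-].
  by rewrite /= in_itv/=; exact: first_side.
move=> /existsNP[s1 /not_implyP[/andP[lo1 s1t] far1]].
right; apply: (@diam_le_ball _ _ _ x) => _ [s2 + <-].
rewrite /= in_itv/= => /andP[ts2 s2hi].
by have [|] := near s1 s2 lo1 s1t ts2 s2hi.
Qed.

End JohnMinimizing.

Theorem theorem1p10 (R : realType) (E : completeNormedModType R)
    (hE : dim_ge2 E) (G : set E) (hG : domain G) (hGE : G `<` [set: E]) :
  (forall c : R, 1 <= c -> John c G -> minimizing G) /\
  (minimizing G <-> exists c1 : R, 1 <= c1 /\ diam_John c1 G).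
Proof.
split=> [c c1 JG|].
  by apply: (@diam_John_minimizing _ _ c);
    [exact: le_trans c1 | exact: John_diam_John].
split=> [|[c [c1 JG]]].
  apply: minimizing_diam_John => G0.
  by apply: boundary_nonempty => //; case: hG.
by apply: (@diam_John_minimizing _ _ c) => //; exact: le_trans c1.
Qed.
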